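(* Let $G$ be a group with identity $1$, let $R$ be an indecomposable commutative ring with unit and $\mathscr G$ a Hausdorff ample $G$-graded groupoid. Let $\mathscr H$ be the interior of the isotropy bundle of $\mathscr G_1$, viewed as a trivially graded groupoid. Let $N$ be the graded normalizer of $D(\mathscr G)$ in $R\mathscr G$ and let $N_{\mathscr H}$ be the normalizer of $D(\mathscr H)=D(\mathscr G)$ in $R\mathscr H$ (with respect to the trivial grading). View $R\mathscr H$ as the subalgebra of $R\mathscr G$ of functions supported on $\mathscr H^{(1)}$. (1) $N_{\mathscr H} = N\cap R\mathscr H$. (2) $\mathscr G$ satisfies the local bisection hypothesis (relative to $R$ and its grading) if and only if $\mathscr H$ does (relative to $R$ and the trivial grading).
   Context: A commutative ring $R$ with unit is indecomposable if $0\neq 1$ and $0,1$ are its only idempotents. Groupoids. A groupoid $\mathscr G$ is a small category with all arrows invertible; $\mathscr G^{(0)}$ is the set of objects (identified with the identity arrows), $\mathscr G^{(1)}$ the set of arrows, $\boldsymbol d,\boldsymbol r$ the domain and range maps; $\alpha\beta$ is defined when $\boldsymbol d(\alpha)=\boldsymbol r(\beta)$. A topological groupoid has topologies making all structure maps continuous; it is étale if $\boldsymbol d$ is a local homeomorphism (then all structure maps are, and $\mathscr G^{(0)}$ is open in $\mathscr G^{(1)}$). A Boolean space is a Hausdorff space with a basis of compact open sets. An ample groupoid is an étale groupoid with $\mathscr G^{(0)}$ a Boolean space; it is Hausdorff if $\mathscr G^{(1)}$ is Hausdorff. The isotropy bundle is the subgroupoid of all arrows $\gamma$ with $\boldsymbol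 d(\gamma)=\boldsymbol r(\gamma)$; its topological interior is an open étale subgroupoid containing $\mathscr G^{(0)}$. A local bisection is an open subset $U\subseteq\mathscr G^{(1)}$ on which $\boldsymbol d$ and $\boldsymbol r$ are injective. Gradings. A $G$-graded groupoid is a topological groupoid with a continuous functor (cocycle) $c\colon\mathscr G\to G$, $G$ being a discrete one-object groupoid; $\mathscr G_g=c^{-1}(g)$ for $g\in G$. $\mathscr G_1$ is a clopen subgroupoid. Groupoid algebra. $R\mathscr G$ is the $R$-module of compactly supported locally constant functions $\mathscr G^{(1)}\to R$ with product $fg(\gamma)=\sum_{\boldsymbol d(\alpha)=\boldsymbol d(\gamma)}f(\gamma\alpha^{-1})g(\alpha)$. It is $G$-graded, the component $R\mathscr G_g$ consisting of the functions supported on $\mathscr G_g$. The diagonal subalgebra $D(\mathscr G)$ is the set of functions supported on $\mathscr G^{(0)}$. Normalizer. For $g\in G$ let $N_g$ be the set of $m\in R\mathscr G_g$ for which there is $m'\in R\mathscr G_{g^{-1}}$ with $mm'm=m$, $m'mm'=m'$ and $mD(\mathscr G)m'\cup m'D(\mathscr G)m\subseteq D(\mathscr G)$. The (graded) normalizer of $D(\mathscr G)$ is $N=\bigcup_{g\in G}N_g$. $\mathscr G$ satisfies the local bisection hypothesis (relative to $R$ and the grading) if $\mathrm{supp}(m)=\{\gamma\mid m(\gamma)\ne0\}$ is a local bisection for every $m\in N$. For a trivially graded groupoid these definitions are applied with $G$ the trivial group. *)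

(* Defs.v *)
From HB Require Import structures.
From mathcomp Require Import all_boot all_algebra.
From mathcomp Require Import all_classical topology.

Set Implicit Arguments.
Unset Strict Implicit.
Unset Printing Implicit Defensive.

Import GRing.Theory.

Local Open Scope classical_set_scope.

Definition indecomposable (R : comPzRingType) : Prop :=
  ((0 : R) <> 1 /\ forall e : R, e * e = e -> e = 0 \/ e = 1)%R.

(* No group instance on unit is provided by the libraries. *)
Definition unit_mul (_ _ : unit) : unit := tt.
Fact unit_mulA : associative unit_mul. Proof. by []. Qed.
Fact unit_mul1 : left_id tt unit_mul. Proof. by case. Qed.
Fact unit_1mul : right_id tt unit_mul. Proof. by case. Qed.
Fact unit_mulV : left_inverse tt id unit_mul. Proof. by []. Qed.
Fact unit_Vmul : right_inverse tt id unit_mul. Proof. by []. Qed.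
HB.instance Definition _ :=
  isGroup.Build unit unit_mulA unit_mul1 unit_1mul unit_mulV unit_Vmul.

(* A topological groupoid is presented by its space of arrows, an object being
   identified with its identity arrow; so dom and rng take values in arrows,
   and the objects are the arrows x with [gdom x = x].  Products are read
   x after y; [gmul x y] is meaningful only when [gdom x = grng y] and is
   arbitrary otherwise.  The objects carry the subspace topology, which is
   forced by the continuity of gdom and of the inclusion of identities. *)
Record topGroupoid := TopGroupoid {
  arrow :> topologicalType;
  gdom : arrow -> arrow;
  grng : arrow -> arrow;
  gmul : arrow -> arrow -> arrow;
  ginv : arrow -> arrow;
  gdom_dom : forall x, gdom (gdom x) = gdom x;
  grng_dom : forall x, grng (gdom x) = gdom x;
  gdom_rng : forall x, gdom (grng x) = grng x;
  grng_rng : forall x, grng (grng x) = grng x;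
  gdom_mul : forall x y, gdom x = grng y -> gdom (gmul x y) = gdom y;
  grng_mul : forall x y, gdom x = grng y -> grng (gmul x y) = grng x;
  gmulA : forall x y z, gdom x = grng y -> gdom y = grng z ->
    gmul x (gmul y z) = gmul (gmul x y) z;
  gmul_dom : forall x, gmul x (gdom x) = x;
  gmul_rng : forall x, gmul (grng x) x = x;
  gdom_inv : forall x, gdom (ginv x) = grng x;
  grng_inv : forall x, grng (ginv x) = gdom x;
  gmul_inv : forall x, gmul x (ginv x) = grng x;
  gmul_invl : forall x, gmul (ginv x) x = gdom x;
  gdom_cont : continuous gdom;
  grng_cont : continuous grng;
  ginv_cont : continuous ginv;
  gmul_cont : {within [set p : arrow * arrow | gdom p.1 = grng p.2],
                 continuous (fun p => gmul p.1 p.2)}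
}.

Arguments gdom {t}.
Arguments grng {t}.
Arguments gmul {t}.
Arguments ginv {t}.

Definition objects (X : topGroupoid) : set X := [set x | gdom x = x].
Arguments objects : clear implicits.

Definition source (X : topGroupoid) (x : X) : set_type (objects X) :=
  exist _ (gdom x) (mem_set (gdom_dom x)).

Definition local_homeomorphism (S T : topologicalType) (f : S -> T) : Prop :=
  forall x, exists U : set S, [/\ open U, U x, open (f @` U) &
    {within U, continuous f} /\
    exists g : T -> S, {within f @` U, continuous g} /\
                       forall y, U y -> g (f y) = y].

Definition etale (X : topGroupoid) : Prop := local_homeomorphism (@source X).

Definition boolean_space (T : topologicalType) : Prop :=
  hausdorff_space T /\ basis [set K : set T | compact K /\ open K].

Definition ample (X : topGroupoid) : Prop :=
  etale X /\ boolean_space (set_type (objects X)).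

(* A G-grading of X: a continuous functor to the discrete group G *)
Definition grading (G : groupType) (X : topGroupoid) (c : X -> G) : Prop :=
  continuous (c : X -> discrete_topology G) /\
  forall x y : X, gdom x = grng y -> c (gmul x y) = (c x * c y)%g.

Definition trivial_grading (X : topGroupoid) : X -> unit := fun=> tt.
Arguments trivial_grading : clear implicits.

Section Subgroupoid.
Variables (X : topGroupoid) (A : set X).

Definition subgroupoid_closed : Prop :=
  [/\ forall x, A x -> A (gdom x),
      forall x, A x -> A (grng x),
      forall x, A x -> A (ginv x) &
      forall x y, A x -> A y -> gdom x = grng y -> A (gmul x y)].

Hypothesis A_closed : subgroupoid_closed.

Notation sA := (set_type A).

(* On composable pairs [insubd] returns the product; its default value only
   serves to make these functions total. *)
Definition sub_dom (x : sA) : sA := insubd x (gdom (val x)).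
Definition sub_rng (x : sA) : sA := insubd x (grng (val x)).
Definition sub_inv (x : sA) : sA := insubd x (ginv (val x)).
Definition sub_mul (x y : sA) : sA := insubd x (gmul (val x) (val y)).

Lemma val_in (x : sA) : A (val x).
Proof. exact: set_mem (valP x). Qed.

Lemma val_sub (u : sA) (x : X) : A x -> val (insubd u x) = x.
Proof. by move=> Ax; rewrite val_insubd (mem_set Ax). Qed.

Lemma val_sub_dom x : val (sub_dom x) = gdom (val x).
Proof. by case: A_closed => h *; rewrite val_sub//; apply/h/val_in. Qed.

Lemma val_sub_rng x : val (sub_rng x) = grng (val x).
Proof. by case: A_closed => _ h *; rewrite val_sub//; apply/h/val_in. Qed.

Lemma val_sub_inv x : val (sub_inv x) = ginv (val x).
Proof. by case: A_closed => _ _ h *; rewrite val_sub//; apply/h/val_in. Qed.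

Lemma sub_composable x y :
  sub_dom x = sub_rng y -> gdom (val x) = grng (val y).
Proof. by move=> e; rewrite -val_sub_dom -val_sub_rng e. Qed.

Lemma val_sub_mul x y : sub_dom x = sub_rng y ->
  val (sub_mul x y) = gmul (val x) (val y).
Proof.
move=> /sub_composable e; case: A_closed => _ _ _ h.
by rewrite val_sub//; apply: h => //; exact: val_in.
Qed.

Lemma val_cont : continuous (val : sA -> X).
Proof. exact: (@initial_continuous sA X set_val). Qed.

Lemma into_sub_cont (T : topologicalType) (f : T -> sA) :
  continuous (val \o f) -> continuous f.
Proof. exact: continuous_comp_initial. Qed.

Fact sub_dom_dom x : sub_dom (sub_dom x) = sub_dom x.
Proof. by apply: val_inj; rewrite !val_sub_dom gdom_dom. Qed.
Fact sub_rng_dom x : sub_rng (sub_dom x) = sub_dom x.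
Proof. by apply: val_inj; rewrite val_sub_rng !val_sub_dom grng_dom. Qed.
Fact sub_dom_rng x : sub_dom (sub_rng x) = sub_rng x.
Proof. by apply: val_inj; rewrite val_sub_dom !val_sub_rng gdom_rng. Qed.
Fact sub_rng_rng x : sub_rng (sub_rng x) = sub_rng x.
Proof. by apply: val_inj; rewrite !val_sub_rng grng_rng. Qed.
Fact sub_dom_mul x y : sub_dom x = sub_rng y ->
  sub_dom (sub_mul x y) = sub_dom y.
Proof.
move=> e; apply: val_inj.
by rewrite !val_sub_dom (val_sub_mul e) gdom_mul //; exact: sub_composable.
Qed.
Fact sub_rng_mul x y : sub_dom x = sub_rng y ->
  sub_rng (sub_mul x y) = sub_rng x.
Proof.
move=> e; apply: val_inj.
by rewrite !val_sub_rng (val_sub_mul e) grng_mul //; exact: sub_composable.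
Qed.
Fact sub_mulA x y z : sub_dom x = sub_rng y -> sub_dom y = sub_rng z ->
  sub_mul x (sub_mul y z) = sub_mul (sub_mul x y) z.
Proof.
move=> xy yz; apply: val_inj; rewrite !val_sub_mul ?sub_rng_mul ?sub_dom_mul //.
by rewrite gmulA //; exact: sub_composable.
Qed.
Fact sub_mul_dom x : sub_mul x (sub_dom x) = x.
Proof.
by apply: val_inj; rewrite val_sub_mul ?sub_rng_dom // val_sub_dom gmul_dom.
Qed.
Fact sub_mul_rng x : sub_mul (sub_rng x) x = x.
Proof.
by apply: val_inj; rewrite val_sub_mul ?sub_dom_rng // val_sub_rng gmul_rng.
Qed.
Fact sub_dom_inv x : sub_dom (sub_inv x) = sub_rng x.
Proof. by apply: val_inj; rewrite val_sub_dom val_sub_inv val_sub_rng gdom_inv. Qed.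
Fact sub_rng_inv x : sub_rng (sub_inv x) = sub_dom x.
Proof. by apply: val_inj; rewrite val_sub_dom val_sub_rng val_sub_inv grng_inv. Qed.
Fact sub_mul_inv x : sub_mul x (sub_inv x) = sub_rng x.
Proof.
apply: val_inj; rewrite val_sub_mul ?sub_rng_inv //.
by rewrite val_sub_inv val_sub_rng gmul_inv.
Qed.
Fact sub_mul_invl x : sub_mul (sub_inv x) x = sub_dom x.
Proof.
apply: val_inj; rewrite val_sub_mul ?sub_dom_inv //.
by rewrite val_sub_inv val_sub_dom gmul_invl.
Qed.
Fact sub_dom_cont : continuous sub_dom.
Proof.
apply: into_sub_cont; rewrite (_ : _ \o _ = gdom \o val).
  by move=> x; apply: continuous_comp; [exact: val_cont|exact: gdom_cont].
by apply/funext => x /=; exact: val_sub_dom.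
Qed.
Fact sub_rng_cont : continuous sub_rng.
Proof.
apply: into_sub_cont; rewrite (_ : _ \o _ = grng \o val).
  by move=> x; apply: continuous_comp; [exact: val_cont|exact: grng_cont].
by apply/funext => x /=; exact: val_sub_rng.
Qed.
Fact sub_inv_cont : continuous sub_inv.
Proof.
apply: into_sub_cont; rewrite (_ : _ \o _ = ginv \o val).
  by move=> x; apply: continuous_comp; [exact: val_cont|exact: ginv_cont].
by apply/funext => x /=; exact: val_sub_inv.
Qed.
Fact sub_mul_cont : {within [set p : sA * sA | sub_dom p.1 = sub_rng p.2],
  continuous (fun p => sub_mul p.1 p.2)}.
Proof.
apply: (@into_sub_cont (subspace _)); apply/subspace_continuousP => -[x y] /= e.
rewrite (val_sub_mul e) => W hW.
have := @gmul_cont X; rewrite subspace_continuousP.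
move=> /(_ (val x, val y) (sub_composable e) W hW) /=.
rewrite /within /= => -[[P Q] /= [Px Qy] PQ].
exists (val @^-1` P, val @^-1` Q) => /=.
  by split; [apply: (@val_cont x P)|apply: (@val_cont y Q)].
move=> [x' y'] /= [Px' Qy'] e'; rewrite (val_sub_mul e').
by apply: (PQ (val x', val y')) => //=; exact: sub_composable.
Qed.

Definition subgroupoid : topGroupoid :=
  TopGroupoid sub_dom_dom sub_rng_dom sub_dom_rng sub_rng_rng
    sub_dom_mul sub_rng_mul sub_mulA sub_mul_dom sub_mul_rng
    sub_dom_inv sub_rng_inv sub_mul_inv sub_mul_invl
    sub_dom_cont sub_rng_cont sub_inv_cont sub_mul_cont.

End Subgroupoid.

Section IsotropyInterior.
Variables (G : groupType) (X : topGroupoid) (c : X -> G).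

(* As c is continuous the set of arrows of degree 1 is open, so that taking the
   interior in X or in the subspace of arrows of degree 1 is the same. *)
Definition isotropy1_interior : set X :=
  [set x : X | gdom x = grng x /\ c x = 1%g]°.

Hypotheses (X_etale : etale X) (c_grading : grading c).

Let c_mul := c_grading.2.

Lemma grading_dom x : c (gdom x) = 1%g.
Proof.
have := c_mul (x := gdom x) (y := gdom x).
rewrite gdom_dom grng_dom => /(_ erefl).
rewrite -{2}(gdom_dom x) gmul_dom => e.
by apply: (@mulgI _ (c (gdom x))); rewrite -e mulg1.
Qed.

Lemma grading_inv x : c (ginv x) = (c x)^-1%g.
Proof.
apply: (@mulgI _ (c x)); rewrite -c_mul ?grng_inv // gmul_inv mulgV.
by rewrite -gdom_inv grading_dom.
Qed.

Lemma ginvK (x : X) : ginv (ginv x) = x.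
Proof.
rewrite -[LHS]gmul_dom gdom_inv grng_inv -gmul_invl.
by rewrite gmulA ?gdom_inv ?grng_inv// gmul_invl gdom_inv gmul_rng.
Qed.

Lemma objects_open : open (objects X).
Proof.
rewrite openE => u /= uu; have [U [oU Uu _ [_ [g [_ gK]]]]] := X_etale u.
have h : nbhs u [set z | U z /\ U (gdom z)].
  apply: filterI; first exact: open_nbhs_nbhs.
  by apply: gdom_cont; rewrite uu; exact: open_nbhs_nbhs.
apply: filterS h => z [Uz Udz]; rewrite /objects /=.
rewrite -[LHS](gK _ Udz) -[RHS](gK _ Uz); congr g.
by apply: val_inj; rewrite /= gdom_dom.
Qed.

Lemma isotropy1_interior_object x : objects X x -> isotropy1_interior x.
Proof.
move=> xx; rewrite /isotropy1_interior /interior.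
have := objects_open; rewrite openE => /(_ x xx).
apply: filterS => z /= zz; rewrite -zz; split; last exact: grading_dom.
by rewrite gdom_dom grng_dom.
Qed.

Lemma isotropy1_interior_closed : subgroupoid_closed isotropy1_interior.
Proof.
split.
- by move=> x _; apply: isotropy1_interior_object; exact: gdom_dom.
- by move=> x _; apply: isotropy1_interior_object; exact: gdom_rng.
- move=> x Hx; have : nbhs (ginv x)
      (ginv @^-1` [set x | gdom x = grng x /\ c x = 1%g]).
    by apply: ginv_cont; rewrite ginvK.
  apply: filterS => z /= [e1 e2]; split.
    by rewrite -grng_inv -e1 gdom_inv.
  by rewrite -[z]ginvK grading_inv e2 invg1.
move=> x y Hx Hy xy.
have [U [oU Uy oV [_ [g [gc gK]]]]] := X_etale y.
have sc : continuous (@source X).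
  exact/continuous_comp_initial/gdom_cont.
have sxy : source (gmul x y) = source y.
  by apply: val_inj; rewrite /= gdom_mul.
pose w z := g (source z).
have wc : {for gmul x y, continuous w}.
  apply: continuous_comp; first exact: sc.
  have := gc; rewrite continuous_open_subspace // => /(_ (source (gmul x y))).
  by apply; rewrite inE sxy; exists y.
have wE : w (gmul x y) = y by rewrite /w sxy gK.
have nV : \forall z \near gmul x y, U (w z) /\ gdom (w z) = gdom z.
  have : nbhs (gmul x y) (@source X @^-1` (@source X @` U)).
    by apply: sc; apply: open_nbhs_nbhs; split => //; rewrite sxy; exists y.
  apply: filterS => z [v Uv vz]; rewrite /w -vz gK //; split => //.
  by have := congr1 val vz.
have nW : \forall z \near gmul x y, gdom (w z) = grng (w z) /\ c (w z) = 1%g.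
  by apply: (wc [set v | gdom v = grng v /\ c v = 1%g]); rewrite wE.
have nP : \forall z \near gmul x y,
    gdom z = gdom (w z) ->
    gdom (gmul z (ginv (w z))) = grng (gmul z (ginv (w z))) /\
    c (gmul z (ginv (w z))) = 1%g.
  have := @gmul_cont X; rewrite subspace_continuousP.
  move=> /(_ (gmul x y, ginv y)) /=; rewrite grng_inv gdom_mul//.
  move=> /(_ erefl [set v | gdom v = grng v /\ c v = 1%g]) /=.
  rewrite /from_subspace /= -gmulA ?grng_inv// gmul_inv -xy gmul_dom.
  move=> /(_ Hx); rewrite /within /= => -[[P Q] /= [nP nQ] PQ].
  have iwc : \forall z \near gmul x y, Q (ginv (w z)).
    by apply: (wc (ginv @^-1` Q)); rewrite wE; exact: ginv_cont.
  apply: filterS2 nP iwc => z Pz Qz e.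
  by apply: (PQ (z, ginv (w z))) => //=; rewrite grng_inv.
rewrite /isotropy1_interior /interior /=.
apply: filterS3 nV nW nP => z [_ e1] [e2 e3] /(_ (esym e1)).
rewrite gdom_mul ?grng_mul ?grng_inv// gdom_inv => -[e4 e5]; split.
  by rewrite -e4 -e2.
move: e5; rewrite c_mul ?grng_inv // grading_inv e3 invg1 mulg1.
by [].
Qed.

Definition isotropy_groupoid : topGroupoid :=
  subgroupoid isotropy1_interior_closed.

End IsotropyInterior.

Definition local_bisection (X : topGroupoid) (U : set X) : Prop :=
  [/\ open U, set_inj U gdom & set_inj U grng].

Section GroupoidAlgebra.
Variables (R : comPzRingType) (X : topGroupoid).
Implicit Types f g : X -> R.

Definition supp f : set X := [set x | f x <> 0%R].

Definition gpd_alg : set (X -> R) :=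
  [set f : X -> R | (forall x : X, \forall y \near x, f y = f x) /\
                    compact (supp f)].

(* For f, g in gpd_alg the sum has finitely many nonzero terms when X is
   étale. *)
Definition conv f g : X -> R := fun x =>
  (\sum_(a \in [set a | gdom a = gdom x]) f (gmul x (ginv a)) * g a)%R.

Definition diagonal_alg : set (X -> R) :=
  [set f : X -> R | gpd_alg f /\ supp f `<=` objects X].

Variables (G : groupType) (c : X -> G).

Definition homogeneous (g : G) : set (X -> R) :=
  [set f : X -> R | gpd_alg f /\ supp f `<=` c @^-1` [set g]].

Definition normalizer_deg (g : G) : set (X -> R) :=
  [set m : X -> R | homogeneous g m /\
     exists m' : X -> R, [/\ homogeneous g^-1%g m',
       conv (conv m m') m = m, conv (conv m' m) m' = m' &
       forall f, diagonal_alg f ->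
         diagonal_alg (conv (conv m f) m') /\
         diagonal_alg (conv (conv m' f) m)]].

Definition normalizer : set (X -> R) := \bigcup_g normalizer_deg g.

Definition local_bisection_hypothesis : Prop :=
  forall m, normalizer m -> local_bisection (supp m).

End GroupoidAlgebra.

Arguments gpd_alg : clear implicits.
Arguments normalizer R {X G} c.
Arguments local_bisection_hypothesis R {X G} c.

Definition extend0 (R : comPzRingType) (X : topGroupoid) (A : set X)
    (f : set_type A -> R) : X -> R :=
  fun x => if insub x is Some y then f y else 0%R.

(* The image of R[H] under extension by zero, for H an open subgroupoid, is the
   set of elements of R[X] supported on H. *)
Lemma extend0_gpd_alg (R : comPzRingType) (X : topGroupoid) (A : set X)
    (A_closed : subgroupoid_closed A) : hausdorff_space X -> open A ->
  extend0 (R := R) (A := A) @` gpd_alg R (subgroupoid A_closed) =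
  [set f | gpd_alg R X f /\ supp f `<=` A].
Proof.
move=> hX oA.
have extE (f : set_type A -> R) (y : set_type A) : extend0 f (val y) = f y.
  by rewrite /extend0 valK.
have ext0 (f : set_type A -> R) x : ~ A x -> extend0 f x = 0%R.
  by move=> nAx; rewrite /extend0 insubN// notin_setE.
have inA x : A x -> exists y : set_type A, val y = x.
  by move=> Ax; exists (exist _ x (mem_set Ax)).
apply/seteqP; split => [_ [f [fl fc] <-]|f [[fl fc] fA]] /=.
  have sE : supp (extend0 f) = val @` supp (f : subgroupoid A_closed -> R).
    apply/seteqP; split => [x|_ [y fy <-]]; rewrite /supp /= ?extE// => fx.
    have [/inA[y yx]|/(ext0 f)//] := pselect (A x).
    by exists y => //; rewrite -(extE f) yx.
  have sc : compact (supp (extend0 f)).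
    rewrite sE; apply: continuous_compact => //.
    by apply: continuous_subspaceT; exact: val_cont.
  split; last by rewrite sE => _ [y _ <-]; exact: val_in.
  split=> // x; have [Ax|nAx] := pselect (A x).
    have [y yx] := inA x Ax; have [_ [[W oW <-] Wy sW]] := fl y.
    have nW : nbhs x W by apply: open_nbhs_nbhs; split; rewrite -?yx.
    have nA : nbhs x A by exact: open_nbhs_nbhs.
    apply: filterS2 nW nA => z Wz /inA[t tz].
    by rewrite -yx -tz !extE; apply: sW; rewrite /= set_valE tz.
  have /closed_openC := compact_closed hX sc; rewrite openE.
  have nx : (~` supp (extend0 f)) x by rewrite /supp /= ext0//; apply.
  by move=> /(_ x nx); apply: filterS => z /= /contrapT ->; rewrite ext0.
exists (f \o val); last first.
  apply/funext => x; have [/inA[y <-]|nAx] := pselect (A x).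
    by rewrite extE.
  by rewrite ext0//; apply: contrapT => fx; apply/nAx/fA => /esym.
split=> [x|F FF Fs]; first exact: (val_cont (fl (val x))).
have [p [fp clp]] := fc (val @ F) _ Fs.
have [y yp] := inA _ (fA _ fp); exists y; split.
  by rewrite /supp /= yp.
move=> B C FB [_ [[W oW <-] Wy sW]].
have [||_ [[t Bt <-] Wt]] := clp (val @` B) W.
- by apply: (@filterS _ F _ B) => // z Bz; exists z.
- by apply: open_nbhs_nbhs; split; rewrite -?yp.
- by exists t; split => //; apply: sW.
Qed.

(* Main.v *)
(* Let m be a normalizer with partner m'.  For f in the diagonal,
   f m = m (m' f m), and if f is the indicator of a compact open set of objects
   then m' f m is idempotent, hence {0,1}-valued as R is indecomposable.
   Evaluating at two arrows of supp m and letting f separate objects shows that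
   on supp m the domain and the range of an arrow determine each other; in
   m' = m' m m' this shows that supp m' runs between the same objects as supp m
   backwards.  So if supp m is isotropic of degree 1, then so is supp m', and
   as it is open it lies in H: this is (1).
   For (2), let m be a normalizer in R[X] and x, y in supp m with the same
   domain.  If U is a compact open bisection with x in U and U included in
   supp m, then m 1_{U^-1} is a normalizer supported on isotropic arrows of
   degree 1 and is nonzero at both x x^-1 and y x^-1, so the hypothesis on H
   gives x = y. *)
Require Import Defs.
From mathcomp Require Import all_boot all_algebra.
From mathcomp Require Import all_classical topology.

Set Implicit Arguments.
Unset Strict Implicit.
Unset Printing Implicit Defensive.

Import GRing.Theory.

Local Open Scope classical_set_scope.
Local Open Scope ring_scope.

(** * Cancellation and inversion in a groupoid *)

Section GroupoidLaws.
Variable X : topGroupoid.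
Implicit Types x y a b : X.

Lemma gmulK a b : gdom b = grng a -> gmul (gmul b a) (ginv a) = b.
Proof. by move=> ba; rewrite -gmulA ?grng_inv// gmul_inv -ba gmul_dom. Qed.

Lemma gmulVK a x : gdom a = gdom x -> gmul (gmul x (ginv a)) a = x.
Proof.
by move=> ax; rewrite -gmulA ?gdom_inv ?grng_inv// gmul_invl ax gmul_dom.
Qed.

Lemma gmulKV a b : gdom b = grng a -> gmul (ginv b) (gmul b a) = a.
Proof. by move=> ba; rewrite gmulA ?gdom_inv// gmul_invl ba gmul_rng. Qed.

Lemma gdom_mulV x a : gdom a = gdom x -> gdom (gmul x (ginv a)) = grng a.
Proof. by move=> ax; rewrite gdom_mul ?gdom_inv ?grng_inv. Qed.

Lemma grng_mulV x a : gdom a = gdom x -> grng (gmul x (ginv a)) = grng x.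
Proof. by move=> ax; rewrite grng_mul ?grng_inv. Qed.

Lemma ginv_mul x y : gdom x = grng y ->
  ginv (gmul x y) = gmul (ginv y) (ginv x).
Proof.
move=> xy; have yx : gdom (ginv y) = grng (ginv x) by rewrite gdom_inv grng_inv.
have zw : gdom (gmul (ginv y) (ginv x)) = grng (gmul x y).
  by rewrite gdom_mul// gdom_inv grng_mul.
rewrite -[RHS](gmulK zw) -[gmul (gmul (ginv y) _) _]gmulA//.
  rewrite gmulKV// gmul_invl -(gdom_mul xy) -grng_inv.
  by rewrite gmul_rng.
by rewrite gdom_inv grng_mul.
Qed.

Lemma grng_object x : objects X x -> grng x = x.
Proof. by rewrite /objects /= => <-; rewrite grng_dom. Qed.

Lemma ginv_object x : objects X x -> ginv x = x.
Proof.
by move=> xx; rewrite -[LHS]gmul_rng grng_inv xx gmul_inv grng_object.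
Qed.

End GroupoidLaws.

(** * The convolution product: supports, associativity, diagonal factors, inversion *)

Section Convolution.
Variables (R : comPzRingType) (X : topGroupoid).
Implicit Types (f g h : X -> R) (x a b : X).

Lemma mulr_fsumr_finite (I : choiceType) (r : R) (P : set I) (F : I -> R) :
  finite_set P -> r * (\sum_(i \in P) F i) = \sum_(i \in P) r * F i.
Proof. exact: fsbig_distrr. Qed.

Lemma mulr_fsuml_finite (I : choiceType) (r : R) (P : set I) (F : I -> R) :
  finite_set P -> (\sum_(i \in P) F i) * r = \sum_(i \in P) F i * r.
Proof.
move=> Pfin; rewrite mulrC mulr_fsumr_finite//.
by apply: eq_fsbigr => i _; rewrite mulrC.
Qed.

Definition fibre_support f x : set X := [set a | gdom a = gdom x /\ f a <> 0].

(** The purely algebraic finiteness needed for associativity; it isolates what compact support over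
    an étale groupoid provides. *)
Definition finite_fibres f : Prop := forall x, finite_set (fibre_support f x).

Lemma convE f g x : conv f g x =
  \sum_(a \in fibre_support g x) f (gmul x (ginv a)) * g a.
Proof.
apply/esym/fsbig_widen => [a []//|a [/= ax ng]].
rewrite (_ : g a = 0) ?mulr0//; apply: contrapT => ga; exact/ng.
Qed.

(** The tool for locating supports: an arrow in the support of a product factors as [x = (x a^-1) a]
    through the two supports. *)
Lemma conv_neq0 f g x : conv f g x <> 0 ->
  exists a, [/\ gdom a = gdom x, f (gmul x (ginv a)) <> 0 & g a <> 0].
Proof.
move=> fgx; apply: contrapT => nex; apply: fgx; apply: fsbig1 => a /= ax.
have [ga|ga] := pselect (g a = 0); first by rewrite ga mulr0.
have [fa|fa] := pselect (f (gmul x (ginv a)) = 0); first by rewrite fa mul0r.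
by exfalso; apply: nex; exists a.
Qed.

Lemma conv_single f g x u : gdom u = gdom x ->
  (forall a, gdom a = gdom x -> f (gmul x (ginv a)) <> 0 -> g a <> 0 ->
    a = u) ->
  conv f g x = f (gmul x (ginv u)) * g u.
Proof.
move=> ux uniq_u.
rewrite -(fsbig_set1 +%R u (fun a => f (gmul x (ginv a)) * g a)).
apply/esym/fsbig_widen => [_ ->//|a [/= ax nau]].
have [ga|ga] := pselect (g a = 0); first by rewrite ga mulr0.
have [fa|fa] := pselect (f (gmul x (ginv a)) = 0); first by rewrite fa mul0r.
by exfalso; exact/nau/uniq_u.
Qed.

(** An arrow in the support of the product is some [b a], where [a] ranges over a finite set and [b]
    has domain [grng a], which leaves finitely many [b] for each [a]. *)
Lemma finite_fibres_conv f g :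
  finite_fibres f -> finite_fibres g -> finite_fibres (conv f g).
Proof.
move=> ff gf x; apply: (@sub_finite_set _ _ (\bigcup_(a in fibre_support g x)
  (gmul^~ a @` fibre_support f (gmul x (ginv a))))).
  move=> y [yx /conv_neq0[a [ay fa ga]]].
  have ax : gdom a = gdom x by rewrite ay.
  exists a => //; exists (gmul y (ginv a)); last exact: gmulVK.
  by split => //; rewrite !gdom_mulV.
by apply: bigcup_finite => [|a _]; [exact: gf|exact/finite_image/ff].
Qed.

Lemma convA f g h : finite_fibres g -> finite_fibres h ->
  conv (conv f g) h = conv f (conv g h).
Proof.
move=> gf hf; apply/funext => x; rewrite convE.
pose A := fibre_support h x; pose B a := fibre_support g (gmul x (ginv a)).
pose E := \bigcup_(a in A) (gmul^~ a @` B a).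
have Efin : finite_set E.
  by apply: bigcup_finite => [|a _]; [exact: hf|exact/finite_image/gf].
(* Both sides equal a double sum over [a] and the product [e = b a]. The finite set [E] of all such
   products does not depend on [a], so the two sums can be exchanged. *)
transitivity (\sum_(a \in A) \sum_(e \in E)
    f (gmul x (ginv e)) * g (gmul e (ginv a)) * h a); last first.
  rewrite -exchange_fsbig//; last exact: hf.
  transitivity (\sum_(e \in E) f (gmul x (ginv e)) * conv g h e).
    apply: eq_fsbigr => e /set_mem [a [ax ha] [b [bx gb] be]].
    have ex : gdom e = gdom x by rewrite -be gdom_mul// bx gdom_mulV.
    rewrite convE mulr_fsumr_finite; last exact: hf.
    rewrite (_ : fibre_support h e = A) ?/A /fibre_support ?ex//.
    by apply: eq_fsbigr => c _; rewrite mulrA.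
  apply: fsbig_widen => [e [a [ax ha] [b [bx gb] /= <-]]|e [/= ex nEe]].
    by rewrite gdom_mul// bx gdom_mulV.
  rewrite (_ : conv g h e = 0) ?mulr0//; apply: contrapT.
  move=> /conv_neq0[a [ae ga ha]]; apply: nEe.
  exists a; first by split; rewrite // ae.
  exists (gmul e (ginv a)); last exact: gmulVK.
  by split => //; rewrite !gdom_mulV// ae.
apply: eq_fsbigr => a /set_mem aA; have [ax ha] := aA.
rewrite convE mulr_fsuml_finite; last exact: gf.
(* For fixed [a] only the products [b a] with [b] in [B a] contribute, and [b] is recovered from
   [b a] by cancelling [a]. *)
have <- : \sum_(e \in gmul^~ a @` B a)
    f (gmul x (ginv e)) * g (gmul e (ginv a)) * h a =
    \sum_(e \in E) f (gmul x (ginv e)) * g (gmul e (ginv a)) * h a.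
  apply: fsbig_widen => [e eB|e [/= [a' [a'x _] [b' [b'x _] eE]] neB]].
    by exists a.
  have ex : gdom e = gdom x by rewrite -eE gdom_mul// b'x gdom_mulV.
  rewrite (_ : g _ = 0) ?mulr0 ?mul0r//; apply: contrapT => ge; apply: neB.
  exists (gmul e (ginv a)); last by rewrite gmulVK// ex.
  by split => //; rewrite !gdom_mulV// ex.
have rb b : B a b -> gdom b = grng a by move=> [-> _]; rewrite gdom_mulV.
rewrite fsbig_image => [|b b' /set_mem/rb bB /set_mem/rb b'B bb']; last first.
  by rewrite -(gmulK bB) bb' gmulK.
apply: eq_fsbigr => b /set_mem/rb bB.
rewrite ginv_mul// gmulK// gmulA//; first by rewrite grng_inv.
by rewrite gdom_inv grng_inv.
Qed.

(** The only arrow of [supp h] that can share the domain of [x] is the unit [gdom x]. *)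
Lemma conv_diagr f h x : supp h `<=` objects X ->
  conv f h x = f x * h (gdom x).
Proof.
move=> hD; rewrite (@conv_single _ _ _ (gdom x)) ?gdom_dom//.
  by rewrite ginv_object ?gmul_dom//; exact: gdom_dom.
by move=> a ax _ /hD; rewrite /objects /= ax.
Qed.

Lemma conv_diagl f h x : supp h `<=` objects X ->
  conv h f x = h (grng x) * f x.
Proof.
move=> hD; rewrite (@conv_single _ _ _ x) ?gmul_inv//.
move=> a ax /hD xa _; rewrite -[RHS](gmulVK ax).
have := xa; rewrite /objects /= gdom_mulV// => <-.
by rewrite gmul_rng.
Qed.

Lemma conv_diagC f h : supp f `<=` objects X -> supp h `<=` objects X ->
  conv f h = conv h f.
Proof.
move=> fD hD; apply/funext => x; rewrite conv_diagr// conv_diagl// mulrC.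
have [->|/fD xx] := pselect (f x = 0); first by rewrite !mulr0.
by rewrite (grng_object xx) (_ : gdom x = x).
Qed.

(* An anti-automorphism: it turns statements on right multiplication into
   statements on left multiplication. *)
Definition star f : X -> R := f \o ginv.

Lemma starK f : star (star f) = f.
Proof. by apply/funext => x; rewrite /star /= ginvK. Qed.

Lemma star_conv f g : star (conv f g) = conv (star g) (star f).
Proof.
apply/funext => x; rewrite /star /conv /=; apply: esym.
(* Right translation by [x] is a bijection from the arrows with domain [grng x] onto those with
   domain [gdom x]. *)
rewrite (reindex_fsbig (gmul^~ x) [set a | gdom a = grng x]); last first.
  split=> [a /= ax|a b /set_mem /= ax /set_mem /= bx ab|b /= bx].
  - by rewrite gdom_mul.
  - by rewrite -(gmulK ax) ab gmulK.
  - by exists (gmul b (ginv x)); rewrite /= ?gmulVK ?gdom_mulV.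
rewrite gdom_inv; apply: eq_fsbigr => a /set_mem /= ax.
rewrite [ginv (gmul x _)]ginv_mul ?grng_inv ?gdom_mul// ginvK gmulK//.
by rewrite mulrC ginv_mul.
Qed.

End Convolution.

(** * Closed equalizers, local constancy, and inverses of bisections *)

Lemma closed_eq_fun (S T : topologicalType) (f g : S -> T) :
  hausdorff_space T -> continuous f -> continuous g ->
  closed [set x | f x = g x].
Proof.
rewrite open_hausdorff => hT fc gc; rewrite -[X in closed X]setCK.
apply: open_closedC; rewrite openE => x /= /eqP.
move=> /hT[[A B] /= [fA gB] [oA oB AB]].
have nA : nbhs x (f @^-1` A).
  by apply: fc; apply: open_nbhs_nbhs; split => //; exact: set_mem.
have nB : nbhs x (g @^-1` B).
  by apply: gc; apply: open_nbhs_nbhs; split => //; exact: set_mem.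
apply: filterS2 nA nB => y /= Ay By fg.
have : (A `&` B) (f y) by split => //; rewrite fg.
by rewrite (eqP AB).
Qed.

Definition locally_constant (T : topologicalType) (V : Type) (f : T -> V) :=
  forall x, \forall y \near x, f y = f x.

Section Inverses.
Variable X : topGroupoid.
Implicit Types U : set X.

Lemma ginv_image U : ginv @` U = ginv @^-1` U.
Proof.
apply/seteqP; split => [_ [u Uu <-]|x Ux]; first by rewrite /= ginvK.
by exists (ginv x) => //; exact: ginvK.
Qed.

Lemma compact_ginv U : compact U -> compact (ginv @` U).
Proof.
move=> cU; apply: continuous_compact => //; apply: continuous_subspaceT.
exact: ginv_cont.
Qed.

Lemma local_bisection_ginv U : local_bisection U -> local_bisection (ginv @` U).
Proof.
move=> [oU Ud Ur]; split.
- rewrite ginv_image; apply: (@open_comp _ _ (@ginv X)) => // x _.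
  exact: ginv_cont.
- move=> _ _ /set_mem[v Uv <-] /set_mem[w Uw <-]; rewrite !gdom_inv => vw.
  by rewrite (Ur v w)// inE.
- move=> _ _ /set_mem[v Uv <-] /set_mem[w Uw <-]; rewrite !grng_inv => vw.
  by rewrite (Ud v w)// inE.
Qed.

End Inverses.

(** * Local sections of the domain map and compact open sets *)

Section EtaleGroupoid.
Variables (X : topGroupoid) (X_etale : etale X).
Implicit Types (x y : X) (U K O : set X).

(** The étale condition moved from the subtype of objects to the space of arrows. Since the objects
    are open, the image of [U] is open among all arrows, and composing the local inverse with
    [source] makes [w] continuous at its points. *)
Lemma local_section x : exists (U : set X) (w : X -> X),
  [/\ open U, U x, open (gdom @` U), forall u, U u -> w (gdom u) = u &
      forall y, (gdom @` U) y -> {for y, continuous w}].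
Proof.
have [U [oU Ux oV [_ [g [gc gK]]]]] := X_etale x.
have sD (u : X) : source (gdom u) = source u.
  by apply: val_inj; rewrite /= gdom_dom.
have [W oW WV] : exists2 W, open W & val @^-1` W = source (X := X) @` U := oV.
exists U, (g \o @source X); split => //.
- rewrite (_ : _ @` _ = W `&` objects X).
    by apply: openI => //; exact: objects_open.
  apply/seteqP; split => [_ [u Uu <-]|y [Wy yy]].
    split; last exact: gdom_dom.
    have : (source (X := X) @` U) (source u) by exists u.
    by rewrite -WV.
  have : (val @^-1` W) (source y) by rewrite /= (_ : gdom y = y).
  rewrite WV => -[u Uu uy]; exists u => //.
  by have := congr1 val uy; rewrite /= => ->.
- by move=> u Uu /=; rewrite sD gK.
- move=> _ [u Uu <-]; apply: continuous_comp.
    exact/continuous_comp_initial/gdom_cont.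
  have := gc; rewrite continuous_open_subspace//; apply.
  by rewrite inE sD; exists u.
Qed.

(** Near [gdom u] every object is the domain of its image under the local section [w], and
    continuity of [w] keeps that image in [O]. *)
Lemma open_gdom_image O : open O -> open (gdom @` O).
Proof.
move=> oO; rewrite openE => _ [u Ou <-].
have [U [w [oU Uu oV wK wc]]] := local_section u.
have nV : nbhs (gdom u) (gdom @` U).
  by apply: open_nbhs_nbhs; split => //; exists u.
have nO : nbhs (gdom u) (w @^-1` O).
  apply: wc; first by exists u.
  by rewrite wK//; exact: open_nbhs_nbhs.
apply: filterS2 nV nO => _ [v Uv <-] /=; rewrite wK// => Ov.
by exists v.
Qed.

Hypothesis X_boolean : boolean_space (set_type (objects X)).

Lemma compact_open_object x O : objects X x -> open O -> O x ->
  exists K, [/\ compact K, open K, K x & K `<=` O `&` objects X].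
Proof.
move=> xx oO Ox; pose s : set_type (objects X) := exist _ x (mem_set xx).
have : nbhs s (val @^-1` O).
  by apply: val_cont; exact: open_nbhs_nbhs.
case: X_boolean => _ [_ /(_ s)] /[apply] -[B [[cB oB] Bs] BO].
have [W oW WB] : exists2 W, open W & val @^-1` W = B := oB.
have BK : val @` B = W `&` objects X.
  apply/seteqP; split => [_ [u Bu <-]|y [Wy yy]].
    by split; [by move: Bu; rewrite -WB|exact: val_in].
  by exists (exist _ y (mem_set yy)) => //; rewrite -WB.
exists (val @` B); split.
- apply: continuous_compact => //; apply: continuous_subspaceT.
  exact: val_cont.
- by rewrite BK; apply: openI => //; exact: objects_open.
- by exists s.
- by move=> _ [u Bu <-]; split; [exact: BO|exact: val_in].
Qed.

Lemma compact_open_section x O : open O -> O x ->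
  exists U, [/\ compact U, open U, U x, U `<=` O & set_inj U gdom].
Proof.
move=> oO Ox; have [U [w [oU Ux oV wK wc]]] := local_section x.
have [||K [cK oK Kx KO]] :=
    @compact_open_object (gdom x) (gdom @` (U `&` O)) (gdom_dom x).
- by apply: open_gdom_image; exact: openI.
- by exists x.
(* The set has two descriptions: as a continuous image of [K] it is compact, as an intersection of
   preimages it is open. *)
have KE : w @` K = U `&` O `&` gdom @^-1` K.
  apply/seteqP; split => [_ [y Ky <-]|y [[Uy Oy] Ky]].
    by have [[u [Uu Ou] uy] _] := KO _ Ky; move: Ky; rewrite -uy wK.
  by exists (gdom y) => //; exact: wK.
exists (w @` K); split.
- apply: continuous_compact => //; apply: continuous_in_subspaceT => y.
  by move=> /set_mem /KO[[u [Uu _] <-] _]; apply: wc; exists u.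
- rewrite KE; apply: openI; first exact: openI.
  by apply: open_comp => // y _; exact: gdom_cont.
- by rewrite KE.
- by rewrite KE => y [[]].
- rewrite KE => u v /set_mem[[Uu _] _] /set_mem[[Uv _] _] uv.
  by rewrite -(wK u)// uv wK.
Qed.

End EtaleGroupoid.

(** * Compactly supported locally constant functions *)

Section GroupoidFunctions.
Variables (R : comPzRingType) (X : topGroupoid) (X_etale : etale X).
Hypothesis X_hausdorff : hausdorff_space X.
Implicit Types (f g h m : X -> R) (x y : X) (U K : set X).

Lemma locally_constant_open f (P : set R) : locally_constant f ->
  open (f @^-1` P).
Proof.
by move=> fl; rewrite openE => x Px; apply: filterS (fl x) => y /= ->.
Qed.

Lemma open_supp f : locally_constant f -> open (supp f).
Proof. exact: (@locally_constant_open f [set r | r <> 0]). Qed.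

(** The support of a locally constant function is closed, so a compact set containing it
    suffices. *)
Lemma gpd_algI f K : locally_constant f -> compact K -> supp f `<=` K ->
  gpd_alg R X f.
Proof.
move=> fl cK fK; split => //; apply: subclosed_compact cK fK.
rewrite -[X in closed X]setCK; apply: open_closedC.
exact: (@locally_constant_open f (~` [set r | r <> 0])).
Qed.

Lemma gpd_alg_finite_fibres f : gpd_alg R X f -> finite_fibres f.
Proof.
(* An infinite fibre would accumulate at a point of the compact support, where
   gdom is locally injective; compact_cover is only stated for pointed spaces. *)
move=> [_ fc] x; apply: contrapT => Sinf.
pose F : set (set X) := [set B | finite_set (fibre_support f x `\` B)].
have F_filter : ProperFilter F.
  apply: Build_ProperFilter; first by rewrite /F /= setD0.
  split=> [|A B FA FB|A B AB]; rewrite /F /=.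
  - by rewrite setDT.
  - by rewrite setDIr finite_setU.
  - by apply: sub_finite_set => y [Sy nBy]; split => // /AB.
have [|p [_ clp]] := fc F F_filter.
  by rewrite /F /= (_ : _ `\` _ = set0)// -subset0 => y [[_ fy] nfy].
have [U [w [oU Up _ wK _]]] := local_section X_etale p.
have nU : nbhs p U by exact: open_nbhs_nbhs.
have [|y [[Sy _] Uy]] := clp (fibre_support f x) U _ nU.
  by rewrite /F /= setDv.
have [|z [[[zx _] nzy] Uz]] := clp (fibre_support f x `\ y) U _ nU.
  by rewrite /F /= setDD; apply: sub_finite_set (finite_set1 y) => z [].
by apply: nzy; rewrite /= -(wK z)// -(wK y)// zx Sy.
Qed.

Definition ind U : X -> R := fun x => (x \in U)%:R.

Lemma ind1 U x : U x -> ind U x = 1.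
Proof. by move=> Ux; rewrite /ind mem_set. Qed.

Lemma ind0 U x : ~ U x -> ind U x = 0.
Proof. by move=> Ux; rewrite /ind memNset. Qed.

Lemma supp_ind U : supp (ind U) `<=` U.
Proof. by move=> x; apply: contra_notP => /ind0. Qed.

Lemma ind_gpd_alg U : compact U -> open U -> gpd_alg R X (ind U).
Proof.
move=> cU oU; apply: (gpd_algI _ cU (@supp_ind U)) => x.
have [Ux|nUx] := pselect (U x).
  have : nbhs x U by exact: open_nbhs_nbhs.
  by apply: filterS => y Uy; rewrite !ind1.
have : nbhs x (~` U).
  apply: open_nbhs_nbhs; split => //; apply: closed_openC.
  exact: compact_closed.
by apply: filterS => y Uy; rewrite !ind0.
Qed.

Lemma ind_diagonal_alg U : compact U -> open U -> U `<=` objects X ->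
  diagonal_alg (ind U).
Proof.
move=> cU oU UD; split; first exact: ind_gpd_alg.
by move=> x /supp_ind /UD.
Qed.

Lemma star_gpd_alg f : gpd_alg R X f -> gpd_alg R X (star f).
Proof.
move=> [fl fc]; apply: (@gpd_algI _ (ginv @` supp f)).
- move=> x; exact: (@ginv_cont X x [set y | f y = f (ginv x)] (fl (ginv x))).
- apply: continuous_compact => //; apply: continuous_subspaceT.
  exact: ginv_cont.
- by move=> x fx; exists (ginv x) => //; exact: ginvK.
Qed.

Lemma star_ind U : star (ind U) = ind (ginv @` U).
Proof.
apply/funext => x; rewrite /star /=.
have [Ux|nUx] := pselect (U (ginv x)).
  by rewrite !ind1//; exists (ginv x) => //; exact: ginvK.
by rewrite !ind0// => -[u Uu ux]; apply: nUx; rewrite -ux ginvK.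
Qed.

(** Compactness comes for free: in a Hausdorff groupoid the composable pairs in [supp f] times
    [supp g] form a compact set, and their products contain the support of the convolution. *)
Lemma conv_gpd_algI f g : gpd_alg R X f -> gpd_alg R X g ->
  locally_constant (conv f g) -> gpd_alg R X (conv f g).
Proof.
move=> [_ fc] [_ gc] fgl.
pose C := [set p : X * X | gdom p.1 = grng p.2].
pose P := supp f `*` supp g `&` C.
apply: (@gpd_algI _ ((fun p => gmul p.1 p.2) @` P)) => //.
  apply: continuous_compact.
    by apply: (@continuous_subspaceW _ _ _ C) => [p []//|]; exact: gmul_cont.
  apply: compact_closedI; first exact: compact_setX.
  apply: closed_eq_fun => // p; apply: continuous_comp.
  - exact: cvg_fst.
  - exact: gdom_cont.
  - exact: cvg_snd.
  - exact: grng_cont.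
move=> x /conv_neq0[a [ax fa ga]].
exists (gmul x (ginv a), a); last exact: gmulVK.
by split; [split|rewrite /C /= gdom_mulV].
Qed.

Lemma conv_diagr_gpd_alg f h : gpd_alg R X f -> diagonal_alg h ->
  gpd_alg R X (conv f h).
Proof.
move=> fA [hA hD]; apply: conv_gpd_algI => // x.
have := @gdom_cont X x _ (hA.1 (gdom x)); apply: filterS2 (fA.1 x) => y fy hy.
by rewrite !conv_diagr// fy hy.
Qed.

(** Each domain fibre meets [U] at most once, so right multiplication by the indicator is
    translation by a single inverse arrow. *)
Lemma conv_ind f U x u : set_inj U gdom -> U u -> gdom u = gdom x ->
  conv f (ind U) x = f (gmul x (ginv u)).
Proof.
move=> inj_U Uu ux; rewrite (@conv_single _ _ _ _ _ u)// ?ind1 ?mulr1//.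
by move=> a ax _ /supp_ind Ua; apply: inj_U; rewrite ?inE// ux.
Qed.

Lemma conv_ind0 f U x : ~ (gdom @` U) (gdom x) -> conv f (ind U) x = 0.
Proof.
move=> nU; apply: contrapT => /conv_neq0[a [ax _ /supp_ind Ua]].
by apply: nU; exists a.
Qed.

(** Over the domains of [U] the translating arrow varies continuously with [x], so the local
    constancy of [f] is inherited. Elsewhere the product vanishes, and it does so on an open set
    because the compact set of domains of [U] is closed. *)
Lemma conv_ind_gpd_alg f U : gpd_alg R X f -> compact U -> open U ->
  set_inj U gdom -> gpd_alg R X (conv f (ind U)).
Proof.
move=> fA cU oU inj_U; apply: conv_gpd_algI => //; first exact: ind_gpd_alg.
move=> x; have [[u Uu ux]|nU] := pselect ((gdom @` U) (gdom x)); last first.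
  have nx : nbhs (gdom x) (~` (gdom @` U)).
    apply: open_nbhs_nbhs; split => //; apply: closed_openC.
    apply: compact_closed => //; apply: continuous_compact => //.
    by apply: continuous_subspaceT; exact: gdom_cont.
  have : nbhs x (gdom @^-1` (~` (gdom @` U))) by exact: gdom_cont.
  by apply: filterS => y nUy; rewrite !conv_ind0.
have [V [w [oV Vu odV wK wc]]] := local_section X_etale u.
have nU : nbhs x (fun y => U (w (gdom y))).
  apply: (@continuous_comp _ _ _ gdom w x); first exact: gdom_cont.
    by apply: wc; rewrite -ux; exists u.
  by rewrite /= -ux wK//; exact: open_nbhs_nbhs.
have nV : nbhs x (gdom @^-1` (gdom @` V)).
  by apply: gdom_cont; apply: open_nbhs_nbhs; split => //; exists u.
(* Multiplication is continuous only along composable pairs, hence the equation kept as a premise;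
   it is discharged once [gdom y] is known to lie in the image of [V]. *)
have nf : \forall y \near x, gdom y = gdom (w (gdom y)) ->
    f (gmul y (ginv (w (gdom y)))) = f (gmul x (ginv u)).
  have := @gmul_cont X; rewrite subspace_continuousP.
  move=> /(_ (x, ginv u)) /=; rewrite grng_inv => /(_ (esym ux)).
  move=> /(_ _ (fA.1 (gmul x (ginv u)))).
  rewrite /within /= => -[[P Q] /= [nP nQ] PQ].
  have nQ' : nbhs x (fun y => Q (ginv (w (gdom y)))).
    apply: (@continuous_comp _ _ _ gdom (ginv \o w) x).
    - exact: gdom_cont.
    - apply: continuous_comp; last exact: ginv_cont.
      by apply: wc; rewrite -ux; exists u.
    - by rewrite /= -ux wK.
  apply: filterS2 nP nQ' => y Py Qy e.
  by apply: (PQ (y, ginv (w (gdom y)))) => //=; rewrite grng_inv.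
apply: filterS3 nU nV nf => y Uy [v Vv vy] fy.
have wy : gdom (w (gdom y)) = gdom y by rewrite -vy wK.
by rewrite (@conv_ind _ _ _ (w (gdom y)))// fy// (@conv_ind _ _ _ u).
Qed.

Lemma ind_conv_gpd_alg f U : gpd_alg R X f -> compact U ->
  local_bisection U -> gpd_alg R X (conv (ind U) f).
Proof.
move=> fA cU /local_bisection_ginv[oU' U'd _].
rewrite -[conv _ _]starK star_conv star_ind.
apply/star_gpd_alg/conv_ind_gpd_alg => //; first exact: star_gpd_alg.
exact: compact_ginv.
Qed.

End GroupoidFunctions.

(** * Normalizing pairs and the supports of normalizers *)

(** The part of the normalizer condition free of degrees and of membership in the algebra. It is
    symmetric in the two functions and can be compared between a groupoid and a subgroupoid. *)
Definition normalizing_pair (R : comPzRingType) (X : topGroupoid)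
    (m m' : X -> R) : Prop :=
  [/\ conv (conv m m') m = m, conv (conv m' m) m' = m' &
      forall f, diagonal_alg f ->
        diagonal_alg (conv (conv m f) m') /\
        diagonal_alg (conv (conv m' f) m)].

Lemma normalizing_pairC (R : comPzRingType) (X : topGroupoid) (m m' : X -> R) :
  normalizing_pair m m' -> normalizing_pair m' m.
Proof. by case=> mm' m'm mD; split => // f /mD[]. Qed.

Section Normalizers.
Variables (R : comPzRingType) (X : topGroupoid) (X_etale : etale X).
Hypothesis X_hausdorff : hausdorff_space X.
Implicit Types (f g h m n : X -> R) (x y : X) (U K : set X).

Let finite_fibresW f : gpd_alg R X f -> finite_fibres f.
Proof. exact: gpd_alg_finite_fibres. Qed.

Let ff_conv f g : finite_fibres f -> finite_fibres g ->
  finite_fibres (conv f g).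
Proof. exact: finite_fibres_conv. Qed.

Let compact_gdom_supp f : gpd_alg R X f -> compact (gdom @` supp f).
Proof.
move=> [_ fc]; apply: continuous_compact => //; apply: continuous_subspaceT.
exact: gdom_cont.
Qed.

Section Pair.
Variables m m' : X -> R.
Hypotheses (mA : gpd_alg R X m) (m'A : gpd_alg R X m').
Hypothesis mm' : normalizing_pair m m'.

Let mf : finite_fibres m := finite_fibresW mA.
Let m'f : finite_fibres m' := finite_fibresW m'A.

Lemma pair_diagonal : diagonal_alg (conv m m').
Proof.
(* The indicator of the domains of supp m is a right unit for m. *)
case: mm' => _ _ /(_ (ind R (gdom @` supp m)))[].
  apply: ind_diagonal_alg => //; first exact: compact_gdom_supp.
    by apply: open_gdom_image => //; exact: (open_supp mA.1).
  by move=> _ [u _ <-]; exact: gdom_dom.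
rewrite (_ : conv m (ind R _) = m)//; apply/funext => x.
rewrite conv_diagr; last first.
  by move=> y /supp_ind[u _ <-]; exact: gdom_dom.
have [->|mx] := pselect (m x = 0); first by rewrite mul0r.
by rewrite ind1 ?mulr1//; exists x.
Qed.

(** Write [m = m m' m] and move [f] past the diagonal element [m m'], with which it commutes. *)
Lemma pair_diagl f : diagonal_alg f ->
  conv f m = conv m (conv (conv m' f) m).
Proof.
case: mm' => mm'm _ _ fD; have ff := finite_fibresW fD.1.
rewrite -!convA//; last exact: ff_conv.
rewrite (conv_diagC pair_diagonal.2 fD.2) convA//; last exact: ff_conv.
by rewrite mm'm.
Qed.

(** By [pair_diagl], [m' f m m' f m = m' f (f m)], and [f] is idempotent. *)
Lemma pair_idempotent f : diagonal_alg f -> conv f f = f ->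
  conv (conv (conv m' f) m) (conv (conv m' f) m) = conv (conv m' f) m.
Proof.
move=> fD fI; have ff := finite_fibresW fD.1.
rewrite [LHS]convA//; last by do !apply: ff_conv.
rewrite -pair_diagl// -convA// [conv (conv m' f) f]convA// fI.
by [].
Qed.

End Pair.

Lemma pair_diagr m m' f : gpd_alg R X m -> gpd_alg R X m' ->
  normalizing_pair m m' -> diagonal_alg f ->
  conv m f = conv (conv (conv m f) m') m.
Proof.
move=> mA m'A mm' fD; have ff := finite_fibresW fD.1.
have mf := finite_fibresW mA; have m'f := finite_fibresW m'A.
have m'mD := pair_diagonal m'A (normalizing_pairC mm').
rewrite [RHS]convA// [RHS]convA//; last exact: ff_conv.
rewrite (conv_diagC fD.2 m'mD.2) -convA//; last exact: ff_conv.
by rewrite -convA//; case: mm' => ->.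
Qed.

Lemma diagonal_idempotent h x : diagonal_alg h -> conv h h = h ->
  objects X x -> h x * h x = h x.
Proof.
move=> [_ hD] /(congr1 (fun k => k x)); rewrite conv_diagr// => hh xx.
by move: hh; rewrite (xx : gdom x = x).
Qed.

Lemma ind_idempotent U : U `<=` objects X ->
  conv (ind R U) (ind R U) = ind R U.
Proof.
move=> UD; apply/funext => x; rewrite conv_diagr; last first.
  by move=> y /supp_ind /UD.
have [Ux|nUx] := pselect (U x); last by rewrite ind0// mul0r.
by rewrite (UD _ Ux : gdom x = x) ind1// mulr1.
Qed.

Hypothesis X_boolean : boolean_space (set_type (objects X)).
Hypothesis R_indec : indecomposable R.

Lemma separate_objects x y : objects X x -> x <> y ->
  exists K, [/\ compact K, open K, K x, ~ K y & K `<=` objects X].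
Proof.
move: X_hausdorff; rewrite open_hausdorff => hX xx /eqP.
move=> /hX[[A B] /= [xA yB] [oA oB AB]].
have [K [cK oK Kx KA]] :=
  compact_open_object X_etale X_boolean xx oA (set_mem xA).
exists K; split => //; last by move=> z /KA[].
move=> /KA[Ay _]; have : (A `&` B) y by split => //; exact: set_mem.
by rewrite (eqP AB).
Qed.

Let idempotent_neq0 (e : R) : e * e = e -> e <> 0 -> e = 1.
Proof. by case: R_indec => _ /(_ e) + ee => /(_ ee)[]. Qed.

Lemma pair_gdom_grng m m' x y :
  gpd_alg R X m -> gpd_alg R X m' -> normalizing_pair m m' ->
  supp m x -> supp m y -> gdom x = gdom y -> grng x = grng y.
Proof.
move=> mA m'A mm' mx my xy; apply: contrapT => rxy.
have [K [cK oK Kx nKy KD]] := separate_objects (gdom_rng x) rxy.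
have kD : diagonal_alg (ind R K) by exact: ind_diagonal_alg.
have hI := pair_idempotent mA m'A mm' kD (ind_idempotent KD).
have hD : diagonal_alg (conv (conv m' (ind R K)) m).
  by case: mm' => _ _ /(_ _ kD)[].
(* At an arrow [z] the left side sees the indicator only at the range of [z], the right side sees
   the idempotent only at the domain. *)
have kmE z : ind R K (grng z) * m z =
    m z * conv (conv m' (ind R K)) m (gdom z).
  by rewrite -(conv_diagl _ _ kD.2) -(conv_diagr _ _ hD.2) -pair_diagl.
have h1 : conv (conv m' (ind R K)) m (gdom x) = 1.
  apply: idempotent_neq0.
    by apply: diagonal_idempotent => //; exact: gdom_dom.
  move=> h0; apply: mx; have := kmE x.
  by rewrite h0 mulr0 ind1// mul1r.
by apply: my; have := kmE y; rewrite -xy h1 mulr1 ind0// mul0r.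
Qed.

(** The mirror image of [pair_gdom_grng]: [K] now separates the domains, and the idempotent
    [m 1_K m'] is evaluated at the common range. *)
Lemma pair_grng_gdom m m' x y :
  gpd_alg R X m -> gpd_alg R X m' -> normalizing_pair m m' ->
  supp m x -> supp m y -> grng x = grng y -> gdom x = gdom y.
Proof.
move=> mA m'A mm' mx my xy; apply: contrapT => dxy.
have [K [cK oK Kx nKy KD]] := separate_objects (gdom_dom x) dxy.
have kD : diagonal_alg (ind R K) by exact: ind_diagonal_alg.
have hI := pair_idempotent m'A mA (normalizing_pairC mm') kD
  (ind_idempotent KD).
have hD : diagonal_alg (conv (conv m (ind R K)) m').
  by case: mm' => _ _ /(_ _ kD)[].
have mkE z : m z * ind R K (gdom z) =
    conv (conv m (ind R K)) m' (grng z) * m z.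
  by rewrite -(conv_diagr _ _ kD.2) -(conv_diagl _ _ hD.2) -pair_diagr.
have h1 : conv (conv m (ind R K)) m' (grng x) = 1.
  apply: idempotent_neq0.
    by apply: diagonal_idempotent => //; exact: gdom_rng.
  move=> h0; apply: mx; have := mkE x.
  by rewrite h0 mul0r ind1// mulr1.
by apply: my; have := mkE y; rewrite -xy h1 mul1r ind0// mulr0.
Qed.

Lemma pair_supp m m' x :
  gpd_alg R X m -> gpd_alg R X m' -> normalizing_pair m m' -> supp m' x ->
  exists y, [/\ supp m y, gdom y = grng x & grng y = gdom x].
Proof.
move=> mA m'A mm' m'x; have m'm := normalizing_pairC mm'.
have := m'x; rewrite {1}/supp /=; case: m'm => <- _ _.
(* The identity [m' = m' m m'] factors [x] as [(x a^-1 b^-1) b a], with outer factors in [supp m']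
   and [b] in [supp m]. Comparing each outer factor with [x] inside [supp m'] gives the two ends of
   [b]. *)
move=> /conv_neq0[a [ax /conv_neq0[b [bxa m'xab mb] m'a]]].
have rax : grng a = grng x.
  exact: (pair_gdom_grng m'A mA (normalizing_pairC mm')).
have bx : gdom b = grng x by rewrite bxa gdom_mulV.
exists b; split => //; rewrite -(gdom_mulV bxa).
apply: (pair_grng_gdom m'A mA (normalizing_pairC mm')) => //.
by rewrite !grng_mulV.
Qed.

(** The diagonal elements [n n'] and [m' m] commute, so [m n n' m' m n] becomes [(m m' m) (n n' n)].
    Diagonal functions are conjugated first by the inner pair, then by the outer one. *)
Lemma normalizing_pair_conv m m' n n' :
  gpd_alg R X m -> gpd_alg R X m' -> gpd_alg R X n -> gpd_alg R X n' ->
  normalizing_pair m m' -> normalizing_pair n n' ->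
  normalizing_pair (conv m n) (conv n' m').
Proof.
have conv_pair p p' q q' : gpd_alg R X p -> gpd_alg R X p' ->
    gpd_alg R X q -> gpd_alg R X q' ->
    normalizing_pair p p' -> normalizing_pair q q' ->
    conv (conv (conv p q) (conv q' p')) (conv p q) = conv p q.
  move=> pA p'A qA q'A pp' qq'.
  have p'pD := pair_diagonal p'A (normalizing_pairC pp').
  have qq'D := pair_diagonal qA qq'.
  move: pA p'A qA q'A => /finite_fibresW pf /finite_fibresW p'f.
  move=> /finite_fibresW qf /finite_fibresW q'f.
  transitivity (conv p (conv (conv (conv q q') (conv p' p)) q)).
    by rewrite !convA//; do !apply: ff_conv.
  rewrite (conv_diagC qq'D.2 p'pD.2).
  transitivity (conv (conv (conv p p') p) (conv (conv q q') q)).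
    by rewrite !convA//; do !apply: ff_conv.
  by case: pp' => -> _ _; case: qq' => ->.
have conj_diag p p' q q' f : gpd_alg R X p -> gpd_alg R X p' ->
    gpd_alg R X q -> gpd_alg R X q' ->
    normalizing_pair p p' -> normalizing_pair q q' -> diagonal_alg f ->
    diagonal_alg (conv (conv (conv p q) f) (conv q' p')).
  move=> /finite_fibresW pf /finite_fibresW p'f.
  move=> /finite_fibresW qf /finite_fibresW q'f [_ _ pD] [_ _ qD] fD.
  have ff := finite_fibresW fD.1.
  rewrite (_ : conv _ _ = conv (conv p (conv (conv q f) q')) p').
    by have [/pD[]] := qD _ fD.
  by rewrite !convA//; do !apply: ff_conv.
move=> mA m'A nA n'A mm' nn'.
have m'm := normalizing_pairC mm'; have n'n := normalizing_pairC nn'.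
split => [||f fD]; first exact: conv_pair; first exact: conv_pair.
by split; exact: conj_diag.
Qed.

End Normalizers.

(** * Indicators of compact open bisections as normalizers *)

Section Bisections.
Variables (R : comPzRingType) (X : topGroupoid) (X_etale : etale X).
Hypothesis X_hausdorff : hausdorff_space X.
Implicit Types (f : X -> R) (U : set X).

Lemma conv_ind_inv U : local_bisection U ->
  conv (conv (ind R U) (ind R (ginv @` U))) (ind R U) = ind R U.
Proof.
move=> bU; have [_ Ud _] := bU; have [_ U'd _] := local_bisection_ginv bU.
apply/funext => x.
have [[u Uu ux]|nU] := pselect ((gdom @` U) (gdom x)); last first.
  by rewrite conv_ind0// ind0// => Ux; apply: nU; exists x.
rewrite (conv_ind _ Ud Uu ux) (conv_ind _ U'd (u := ginv u)).
- by rewrite ginvK gmulVK.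
- by exists u.
- by rewrite gdom_mulV// gdom_inv.
Qed.

Lemma conv_ind_diag_inv U f : compact U -> local_bisection U ->
  diagonal_alg f ->
  diagonal_alg (conv (conv (ind R U) f) (ind R (ginv @` U))).
Proof.
move=> cU [oU Ud Ur] fD; split.
  rewrite -star_ind; set k := conv _ _; rewrite -(starK k) star_conv starK.
  apply: star_gpd_alg => //; apply: ind_conv_gpd_alg => //.
  apply: star_gpd_alg => //; apply: conv_diagr_gpd_alg => //.
  exact: ind_gpd_alg.
(* An arrow [x] in the support yields [u] in [U] with [x u] in [U]. Both have the same domain, so
   [x u = u] and [x] is a unit. *)
move=> x /conv_neq0[a [+ + /supp_ind[u Uu ua]]]; rewrite -ua.
rewrite gdom_inv ginvK => ux; rewrite (conv_diagr _ _ fD.2) => k0.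
have Uxu : U (gmul x u).
  by apply: contrapT => nU; apply: k0; rewrite ind0// mul0r.
have xuu : gmul x u = u.
  by apply: Ud; rewrite ?inE// gdom_mul.
have /esym := gmulK (esym ux); rewrite xuu gmul_inv => ->.
exact: gdom_rng.
Qed.

Lemma normalizing_pair_ind U : compact U -> local_bisection U ->
  normalizing_pair (ind R U) (ind R (ginv @` U)).
Proof.
move=> cU bU; have bU' := local_bisection_ginv bU.
have UK : ginv @` (ginv @` U) = U.
  by rewrite !ginv_image; apply/seteqP; split => x; rewrite /= ginvK.
split; first exact: conv_ind_inv.
  by have := conv_ind_inv bU'; rewrite UK.
move=> f fD; split; first exact: conv_ind_diag_inv.
by have := conv_ind_diag_inv (compact_ginv cU) bU' fD; rewrite UK.
Qed.

End Bisections.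

(** * Extension by zero from an open subgroupoid *)

Section Extension.
Variables (R : comPzRingType) (X : topGroupoid) (A : set X).
Hypothesis A_closed : subgroupoid_closed A.

Notation H := (subgroupoid A_closed).
Notation ext := (extend0 (R := R) (A := A)).
Implicit Types (f g : H -> R).

Lemma val_gdom (y : H) : val (gdom y) = gdom (val y).
Proof. exact: val_sub_dom. Qed.

Lemma val_grng (y : H) : val (grng y) = grng (val y).
Proof. exact: val_sub_rng. Qed.

Lemma val_gmul_ginv (y a : H) : gdom a = gdom y ->
  val (gmul y (ginv a)) = gmul (val y) (ginv (val a)).
Proof.
move=> ay; rewrite -(val_sub_inv A_closed); apply: (val_sub_mul A_closed).
by have /esym := grng_inv a; rewrite ay.
Qed.

Lemma extend0_val f (y : H) : ext f (val y) = f y.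
Proof. by rewrite /extend0 valK. Qed.

Lemma extend0_out f x : ~ A x -> ext f x = 0.
Proof. by move=> nAx; rewrite /extend0 insubN// notin_setE. Qed.

Lemma supp_extend0 f : supp (ext f) = val @` supp f.
Proof.
apply/seteqP; split => [x|_ [y fy <-]]; last by rewrite /supp /= extend0_val.
have [Ax|/(extend0_out f)//] := pselect (A x); rewrite /supp /=.
rewrite -[x]/(val (exist _ x (mem_set Ax) : H)) extend0_val => fx.
by exists (exist _ x (mem_set Ax)).
Qed.

Lemma extend0_inj : injective (ext : (H -> R) -> X -> R).
Proof.
by move=> f g fg; apply/funext => y; rewrite -!extend0_val fg.
Qed.

Lemma extend0_conv f g : ext (conv f g) = conv (ext f) (ext g).
Proof.
apply/funext => x; have [Ax|nAx] := pselect (A x); last first.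
  (* A nonzero term would write [x] as a product of two arrows of [A], which is closed under
     products. *)
  rewrite extend0_out//; apply/esym; apply: contrapT => /conv_neq0[a [ax]].
  change (supp (ext f) (gmul x (ginv a)) -> supp (ext g) a -> False).
  rewrite !supp_extend0 => -[b _ bE] [a' _ aE]; apply: nAx.
  rewrite -(gmulVK ax) -bE -aE; case: A_closed => _ _ _; apply.
  - exact: val_in.
  - exact: val_in.
  - by rewrite bE aE gdom_mulV.
pose y : H := exist _ x (mem_set Ax).
rewrite -[x]/(val y) extend0_val /conv.
rewrite -[RHS](@fsbig_widen _ _ _ _ (val @` [set a : H | gdom a = gdom y])).
- rewrite fsbig_image; last by move=> a b _ _; exact: val_inj.
  apply: eq_fsbigr => a /set_mem /= ay; rewrite extend0_val -extend0_val.
  by rewrite val_gmul_ginv.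
- move=> _ [a ay <-]; change (gdom (val a) = gdom (val y)).
  by rewrite -!val_gdom (ay : gdom a = gdom y).
- move=> a [/= ax na]; rewrite (_ : ext g a = 0) ?mulr0//; apply: contrapT.
  change (supp (ext g) a -> False); rewrite supp_extend0 => -[b _ bE].
  apply: na; exists b => //; apply: val_inj.
  by rewrite !val_gdom bE.
Qed.

Hypotheses (X_hausdorff : hausdorff_space X) (A_open : open A).

Lemma extend0_gpd_algE f : gpd_alg R H f <-> gpd_alg R X (ext f).
Proof.
have E := extend0_gpd_alg R A_closed X_hausdorff A_open.
split=> [fA|fA].
  have : (ext @` gpd_alg R H) (ext f) by exists f.
  by rewrite E => -[].
have : [set f | gpd_alg R X f /\ supp f `<=` A] (ext f).
  by split => //; rewrite supp_extend0 => _ [y _ <-]; exact: val_in.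
by rewrite -E => -[g gA /extend0_inj <-].
Qed.

Lemma extend0_surj (m : X -> R) : gpd_alg R X m -> supp m `<=` A ->
  exists2 f : H -> R, gpd_alg R H f & ext f = m.
Proof.
move=> mA mS; have : [set f | gpd_alg R X f /\ supp f `<=` A] m by [].
by rewrite -(extend0_gpd_alg R A_closed).
Qed.

Lemma extend0_diagonal_algE f : diagonal_alg f <-> diagonal_alg (ext f).
Proof.
rewrite /diagonal_alg /= -extend0_gpd_algE supp_extend0.
split=> -[fA fD]; split => //.
  move=> _ [y /fD yy <-]; rewrite /objects /=.
  by rewrite -val_gdom yy.
move=> y fy; apply: val_inj; rewrite val_gdom.
by apply: fD; exists y.
Qed.

Hypothesis A_objects : objects X `<=` A.

(** As [A] contains all objects, every diagonal function on [X] is the extension of a diagonal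
    function on the subgroupoid, so both conditions range over the same functions. *)
Lemma extend0_normalizing_pair f g :
  normalizing_pair f g <-> normalizing_pair (ext f) (ext g).
Proof.
split=> -[fgf gfg D]; split => [||h hD].
- by rewrite -!extend0_conv fgf.
- by rewrite -!extend0_conv gfg.
- have [k _ kh] := extend0_surj hD.1 (subset_trans hD.2 A_objects).
  move: hD; rewrite -kh -!extend0_conv -!extend0_diagonal_algE.
  exact: D.
- by apply: extend0_inj; rewrite !extend0_conv.
- by apply: extend0_inj; rewrite !extend0_conv.
- rewrite !extend0_diagonal_algE !extend0_conv.
  exact/D/extend0_diagonal_algE.
Qed.

End Extension.

(** * Normalizers and bisections for the interior of the degree 1 isotropy *)

Theorem proposition4p9 (G : groupType) (R : comPzRingType)
    (R_indec : indecomposable R) (X : topGroupoid) (X_ample : ample X)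
    (X_hausdorff : hausdorff_space X) (c : X -> G) (c_grading : grading c) :
  let H : topGroupoid := isotropy_groupoid (proj1 X_ample) c_grading in
  let ext : (H -> R) -> (X -> R) :=
    extend0 (A := isotropy1_interior c) in
  ext @` normalizer R (trivial_grading H)
    = normalizer R c `&` ext @` gpd_alg R H
  /\ (local_bisection_hypothesis R c <->
      local_bisection_hypothesis R (trivial_grading H)).
Proof.
have [X_etale X_boolean] := X_ample.
set A := isotropy1_interior c.
pose AC := isotropy1_interior_closed (proj1 X_ample) c_grading.
move=> H ext.
have oA : open A by exact: open_interior.
have AD : objects X `<=` A by move=> x; exact: isotropy1_interior_object.
have AI x : A x -> gdom x = grng x /\ c x = 1%g by exact: interior_subset.
have AO (O : set X) : open O ->
    (forall x, O x -> gdom x = grng x /\ c x = 1%g) -> O `<=` A.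
  move=> oO OI x Ox; apply: (filterS OI); exact: open_nbhs_nbhs.
have extA f : supp (ext f) `<=` A.
  by rewrite (supp_extend0 (A_closed := AC)) => _ [y _ <-]; exact: val_in.
have gpdE f : gpd_alg R H f <-> gpd_alg R X (ext f).
  exact: extend0_gpd_algE.
have pairE f g : normalizing_pair f g <-> normalizing_pair (ext f) (ext g).
  exact: extend0_normalizing_pair.
have gdom_grng := pair_gdom_grng X_etale X_hausdorff X_boolean R_indec.
have grng_gdom := pair_grng_gdom X_etale X_hausdorff X_boolean R_indec.
have part1 : ext @` normalizer R (trivial_grading H)
    = normalizer R c `&` ext @` gpd_alg R H.
  apply/seteqP; split => [_ [f [[] _ [[fA _] [f' [[f'A _] p1 p2 p3]]]] <-]|].
    split; last by exists f.
    have /pairE[q1 q2 q3] : normalizing_pair f f' by [].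
    exists 1%g => //; split.
      by split => [|x /extA /AI[]//]; exact/gpdE.
    exists (ext f'); split => //; split; first exact/gpdE.
    by move=> x /extA /AI[_ cx]; rewrite /= cx invg1.
  move=> m [[g _ [[mA mg] [m' [[m'A m'g] p1 p2 p3]]]] [f fA fm]].
  have mm' : normalizing_pair m m' by [].
  have mI x : supp m x -> A x by rewrite -fm; exact: extA.
  have m'S : supp m' `<=` A.
    apply: AO; first exact: (open_supp m'A.1).
    move=> x m'x.
    (* The degree [g] is arbitrary when [m = 0]. Here [x] supplies an arrow [y] of [supp m], whose
       degree is both [g] and 1, so [x] has degree 1 as well. *)
    have [y [my yx xy]] := pair_supp X_etale X_hausdorff X_boolean R_indec
      mA m'A mm' m'x.
    have [dry cy] := AI _ (mI _ my); split; first by rewrite -xy -yx dry.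
    by rewrite (m'g _ m'x) -(mg _ my) cy invg1.
  have [f' f'A f'm'] := extend0_surj AC X_hausdorff oA m'A m'S.
  exists f => //; exists tt => //.
  have [|q1 q2 q3] := (pairE f f').2; first by rewrite fm (f'm' : ext f' = m').
  by split => //; exists f'; split.
split; first exact: part1.
split=> [LB f Nf|LB m [g _ [[mA mg] [m' [[m'A m'g] p1 p2 p3]]]]].
  (* By (1) the extension of [f] is a normalizer on [X]; injectivity on its support descends along
     [val]. *)
  have [] : (normalizer R c `&` ext @` gpd_alg R H) (ext f).
    by rewrite -part1; exists f.
  move=> /LB[_ extd extr] [f' f'A /extend0_inj f'f].
  have suppf y : supp f y -> val y \in supp (ext f).
    by move=> fy; rewrite inE (supp_extend0 (A_closed := AC)); exists y.
  split; first by rewrite -f'f; exact: (open_supp f'A.1).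
    move=> x y /set_mem/suppf fx /set_mem/suppf fy.
    move=> /(congr1 val); rewrite !val_gdom => xy.
    exact/val_inj/extd.
  move=> x y /set_mem/suppf fx /set_mem/suppf fy.
  move=> /(congr1 val); rewrite !val_grng => xy.
  exact/val_inj/extr.
have mm' : normalizing_pair m m' by [].
have LBX n : normalizer R c n -> gpd_alg R X n -> supp n `<=` A ->
    set_inj (supp n) gdom.
  move=> nN nA nS.
  have [f fA fn] := extend0_surj AC X_hausdorff oA nA nS.
  have : (normalizer R c `&` ext @` gpd_alg R H) n by split => //; exists f.
  rewrite -part1 => -[k /LB[_ kd _] <-] x y.
  rewrite !inE !(supp_extend0 (A_closed := AC)).
  move=> -[x' kx <-] [y' ky <-] xy; congr (val _); apply: kd; rewrite ?inE//.
  by apply: val_inj; rewrite !val_gdom.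
have inj_d x y : supp m x -> supp m y -> gdom x = gdom y -> x = y.
  move=> mx my xy.
  have [U [cU oU Ux Um Ud]] :=
    compact_open_section X_etale X_boolean (open_supp mA.1) mx.
  (* Only the domain map is injective on [U] by construction. Inside [supp m] equal ranges force
     equal domains, so the range map is injective too. *)
  have bU : local_bisection U.
    split => // u v Uu Uv uv; apply: Ud => //.
    apply: (grng_gdom _ _ _ _ mA m'A mm') => //.
      exact/Um/set_mem.
    exact/Um/set_mem.
  have bU' := local_bisection_ginv bU; have cU' := compact_ginv cU.
  have [oU' U'd _] := bU'; have [_ _ Ur] := bU.
  pose n := conv m (ind R (ginv @` U)).
  pose n' := conv (ind R U) m'.
  have nA : gpd_alg R X n by exact: conv_ind_gpd_alg.
  have n'A : gpd_alg R X n' by exact: ind_conv_gpd_alg.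
  have nn' : normalizing_pair n n'.
    apply: normalizing_pair_conv => //; try exact: ind_gpd_alg.
    have := normalizing_pair_ind R X_etale X_hausdorff cU bU.
    exact: normalizing_pairC.
  have [c_cont cM] := c_grading.
  (* Such a [z] equals [(z u) u^-1] with [z u] and [u] in [supp m]. They share a domain, hence a
     range, and both have degree [g]. *)
  have nI z : supp n z -> gdom z = grng z /\ c z = 1%g.
    move=> /conv_neq0[a [+ + /supp_ind[u Uu ua]]]; rewrite -ua.
    rewrite gdom_inv ginvK => uz mzu; have /esym uz' := uz; split.
      rewrite -uz -(grng_mul uz').
      apply: (gdom_grng _ _ _ _ mA m'A mm') => //.
        exact: Um.
      by rewrite gdom_mul.
    by rewrite -(gmulK uz') cM ?grng_inv ?gdom_mul// grading_inv// (mg _ mzu)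
      (mg _ (Um _ Uu)) mulgV.
  have n'I z : supp n' z -> c z = 1%g.
    move=> /conv_neq0[a [az /supp_ind Uza m'a]].
    by rewrite -(gmulVK az) cM ?gdom_mulV// (mg _ (Um _ Uza)) (m'g _ m'a) mulgV.
  have nN : normalizer R c n.
    exists 1%g => //; split; first by split => // z /nI[].
    case: nn' => q1 q2 q3; exists n'; split => //.
    by split => // z /n'I zc; rewrite /= zc invg1.
  have nd := LBX n nN nA (AO _ (open_supp nA.1) (fun z => @nI z)).
  (* The arrow of [U^-1] over the domain of [z x^-1] is [x^-1], so [n] takes there the value
     [m z]. *)
  have nE z : supp m z -> gdom z = gdom x -> supp n (gmul z (ginv x)).
    move=> mz zx; rewrite /supp /n /= (conv_ind _ U'd (u := ginv x)).
    - by rewrite ginvK gmulVK.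
    - by exists x.
    - by rewrite gdom_inv gdom_mulV.
  have : gmul x (ginv x) = gmul y (ginv x).
    apply: nd; rewrite ?inE; [exact: nE|exact: nE|].
    by rewrite !gdom_mulV.
  by move=> /(congr1 (gmul^~ x)); rewrite !gmulVK.
split; first exact: (open_supp mA.1).
  by move=> x y /set_mem mx /set_mem my; exact: inj_d.
(* Injectivity of the range reduces to that of the domain, as equal ranges in [supp m] force equal
   domains. *)
move=> x y /set_mem mx /set_mem my xy; apply: inj_d => //.
exact: (grng_gdom _ _ _ _ mA m'A mm').
Qed.
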